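(* Let $([n],\phi)$ be an $n$-component semicoherent system with continuous i.i.d. component lifetimes, partitioned into $r$ disjoint semicoherent modules $(A_j,\chi_j)$, $j=1,\ldots,r$, with $n_j=|A_j|$ (so $\sum_{j=1}^r n_j=n$), and let $\psi\colon\{0,1\}^r\to\{0,1\}$ be the structure function of the partition of the system into modules, i.e. $$\phi(\mathbf{x})=\psi\big(\chi_1(\mathbf{x}^{A_1}),\ldots,\chi_r(\mathbf{x}^{A_r})\big),\qquad \mathbf{x}^{A_j}=(x_i)_{i\in A_j}.$$ Let $(\overline{S}_0,\ldots,\overline{S}_n)$ be the tail signature of the system, let $(\overline{S}_{j,0},\ldots,\overline{S}_{j,n_j})$ be the tail signature of module $j$, let $h_\psi$ be the reliability function of $\psi$, let $h_\phi^R$ be the $n$-reflected polynomial of the diagonal section of the reliability function $h_\phi$ of $\phi$, and let $h_{\chi_j}^R$ be the $n_j$-reflected polynomial of the diagonal section of the reliability function $h_{\chi_j}$ of $\chi_j$. Then the tail signature of the system is determined by $\psi$ and the tail signatures of the modules through the following identities: for $x\neq 0$, $$\sum_{k=0}^n\binom{n}{k}\,\overline{S}_k\,(x-1)^k = h_\phi^R(x)=x^n\,h_\psi\big(x^{-n_1}h_{\chi_1}^R(x),\ldots,x^{-n_r}h_{\chi_r}^R(x)\big),$$ where, for $j=1,\ldots,r$, $$h_{\chi_j}^R(x)=\sum_{k=0}^{n_j}\binom{n_j}{k}\,\overline{S}_{j,k}\,(x-1)^k .$$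
   Context: Let $[n]=\{1,\ldots,n\}$. An $n$-component system $([n],\phi)$ has a structure function $\phi\colon\{0,1\}^n\to\{0,1\}$; subsets $A\subseteq[n]$ are identified with Boolean vectors $\mathbf{x}\in\{0,1\}^n$ via $x_i=1$ iff $i\in A$, so one writes $\phi(A)$. The system is semicoherent if $\phi$ is nondecreasing in each variable, $\phi(0,\ldots,0)=0$ and $\phi(1,\ldots,1)=1$. A module $(A_j,\chi_j)$ consists of a set $A_j\subseteq[n]$ of components and a structure function $\chi_j\colon\{0,1\}^{A_j}\to\{0,1\}$, and is regarded as a system with $n_j=|A_j|$ components; the sets $A_1,\ldots,A_r$ form a partition of $[n]$. The components have lifetimes $T_1,\ldots,T_n$, which are i.i.d. with a continuous distribution; $T_S$ is the system lifetime (the system works at time $t$ iff $\phi(\{i: T_i>t\})=1$), and $T_{k:n}$ is the $k$th smallest of $T_1,\ldots,T_n$. The signature is $\mathbf{s}=(s_1,\ldots,s_n)$ with $s_k=\Pr(T_S=T_{k:n})$. The tail signature is $(\overline{S}_0,\ldots,\overline{S}_n)$ with $$\overline{S}_k=\sum_{i=k+1}^n s_i=\frac{1}{\binom{n}{n-k}}\sum_{A\subseteq[n],\,|A|=n-k}\phi(A),$$ the second equality being Boland's known formula. The tail signature of module $j$ is defined in the same way, with $(A_j,\chi_j)$ and $n_j$ in place of $([n],\phi)$ and $n$. The reliability function of a structure function $\phi\colon\{0,1\}^n\to\{0,1\}$ is its multilinear extension: the unique polynomial function $h_\phi(\mathbf{x})=\sum_{A\subseteq[n]}c(A)\prod_{i\in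 A}x_i$ of degree at most one in each variable that agrees with $\phi$ on $\{0,1\}^n$, i.e. $c(A)=\sum_{B\subseteq A}(-1)^{|A|-|B|}\phi(B)$ (evaluated as a polynomial at arbitrary real arguments when needed); similarly for $\psi$ and $\chi_j$. The diagonal section of a function $f$ of several variables is $f(x)=f(x,\ldots,x)$. For a univariate polynomial $f(x)=a_mx^m+\cdots+a_1x+a_0$ of degree at most $m$, its $m$-reflected polynomial is $f^R(x)=a_0x^m+a_1x^{m-1}+\cdots+a_m$, equivalently $f^R(x)=x^mf(1/x)$. *)

(* Defs.v *)
From HB Require Import structures.
From mathcomp Require Export all_boot all_order all_algebra.
From mathcomp Require Export all_classical all_reals all_analysis.
Export Order.TTheory GRing.Theory Num.Theory.
Export numFieldNormedType.Exports.

Set Implicit Arguments.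
Unset Strict Implicit.
Unset Printing Implicit Defensive.

Local Open Scope ring_scope.

(* Everything is parametrized by a finite type I of components, so that the
   same notions apply to a system on 'I_n, to a module on the subtype
   {i : 'I_n | i \in A}, and to the organizing structure on 'I_r. *)
Definition structure_fun (I : finType) := {ffun I -> bool} -> bool.

Definition char_vec (I : finType) (A : {set I}) : {ffun I -> bool} :=
  [ffun i => i \in A].

Definition restrict_vec (I : finType) (A : {set I}) (x : {ffun I -> bool}) :
  {ffun {i : I | i \in A} -> bool} := [ffun i => x (val i)].

Definition nondecreasing_each (I : finType) (phi : structure_fun I) : Prop :=
  forall (i : I) (x y : {ffun I -> bool}),
    (forall k, k != i -> x k = y k) -> (x i <= y i)%N -> (phi x <= phi y)%N.

Definition semicoherent (I : finType) (phi : structure_fun I) : Prop :=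
  [/\ nondecreasing_each phi,
      phi [ffun=> false] = false &
      phi [ffun=> true] = true].

(* K is any commutative ring: over the reals this is the polynomial function,
   over {poly R} it yields univariate sections as polynomials. *)
Definition mobius_coef (K : comNzRingType) (I : finType)
    (phi : structure_fun I) (A : {set I}) : K :=
  \sum_(B : {set I} | B \subset A)
    (-1) ^+ (#|A| - #|B|) * (phi (char_vec B))%:R.

Definition reliability (K : comNzRingType) (I : finType)
    (phi : structure_fun I) (x : I -> K) : K :=
  \sum_(A : {set I}) mobius_coef K phi A * \prod_(i in A) x i.

Definition diag_reliability (R : comNzRingType) (I : finType)
    (phi : structure_fun I) : {poly R} :=
  reliability phi (fun=> 'X).

(* Meant for f of degree at most m. *)
Definition reflected (R : comNzRingType) (m : nat) (f : {poly R}) : {poly R} :=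
  \poly_(i < m.+1) f`_(m - i).

Section Lifetimes.
Context d (Omega : measurableType d) (R : realType) (P : probability Omega R).
Context (I : finType) (T : I -> {RV P >-> R}).

Definition mutually_independent : Prop :=
  forall (J : {set I}) (B : I -> set R), (forall i, measurable (B i)) ->
    P (\big[setI/setT]_(i in J) (T i @^-1` B i)%classic) =
    (\prod_(i in J) P (T i @^-1` B i)%classic)%E.

Definition identically_distributed : Prop :=
  forall (i j : I) (B : set R), measurable B ->
    distribution P (T i) B = distribution P (T j) B.

Definition continuously_distributed : Prop :=
  forall i : I, continuous (cdf (T i)).

Definition iid_continuous : Prop :=
  [/\ mutually_independent, identically_distributed
    & continuously_distributed].

(* The set of times at which a semicoherent system works is a half-line
   ]-oo, T_S[. *)
Definition system_lifetime (phi : structure_fun I) (w : Omega) : R :=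
  sup [set t : R | phi [ffun i => t < T i w]]%classic.

(* k-th smallest lifetime, for 1 <= k <= #|I|. *)
Definition order_stat (k : nat) (w : Omega) : R :=
  nth 0 (sort <=%R [seq T i w | i <- enum I]) k.-1.

Definition signature (phi : structure_fun I) (k : nat) : R :=
  fine (P [set w | system_lifetime phi w = order_stat k w]%classic).

Definition tail_signature (phi : structure_fun I) (k : nat) : R :=
  \sum_(k.+1 <= i < #|I|.+1) signature phi i.

End Lifetimes.

(* Main.v *)
Require Import Defs.
From mathcomp Require Import ring measurable_realfun.

Set Implicit Arguments.
Unset Strict Implicit.
Unset Printing Implicit Defensive.

Local Open Scope ring_scope.

(* Let B_m(w) be the set of the m components with the longest lifetimes at the
   sample point w. Lifetimes are almost surely distinct because their common law
   has no atoms, so B_m is almost surely defined, and exchangeability makes it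
   uniform among the sets of size m. Almost surely T_S = T_{k:n} iff phi holds at
   B_{n-k+1} and fails at B_{n-k}; summing over the ranks above k telescopes and
   gives Boland's formula
     C(n, k) * S_k = sum of phi(B) over the sets B of size n - k.
   Hence sum_k C(n, k) S_k (x - 1)^k = sum_B phi(B) (x - 1)^(n - |B|), which is
   the reflected polynomial by the binomial expansion over supersets of B.

   The factorization of h_phi through h_psi and the h_chi_j holds as a
   polynomial identity in n variables: both sides are affine in each variable
   and they agree at Boolean points. It is then evaluated at (1/x, ..., 1/x). *)

(** * Reliability functions *)

(* With (a, b) = (x, 1) this turns the Moebius form of the reliability function
   into the expected value of phi; with (a, b) = (1, x) it computes the
   reflected diagonal section. *)
Lemma sum_supersets (K : comNzRingType) (I : finType) (B : {set I})
    (a b : I -> K) :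
  \sum_(A : {set I} | B \subset A) (-1) ^+ (#|A| - #|B|) *
     (\prod_(i in A) a i * \prod_(i in ~: A) b i) =
  \prod_(i in B) a i * \prod_(i in ~: B) (b i - a i).
Proof.
(* Expanding [\prod_i (F i + G i)] over the set [A] of indices where [F] is chosen leaves only
   supersets of [B], as [G] vanishes on [B]; each index of [A :\: B] contributes a sign. *)
pose F i := if i \in B then a i else - a i.
pose G i := if i \in B then 0 else b i.
have -> : \prod_(i in B) a i * \prod_(i in ~: B) (b i - a i) =
          \prod_i (F i + G i).
  rewrite [RHS](bigID (mem B)) /=; congr (_ * _).
    by apply: eq_bigr => i iB; rewrite /F /G iB addr0.
  by apply: eq_big => i; rewrite ?inE // => iB; rewrite /F /G (negbTE iB) addrC.
rewrite bigA_distr big_mkcond /=; apply: eq_bigr => A _.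
have [BA|/fintype.subsetPn[i iB iA]] := ifPn; last first.
  by rewrite (bigD1 i) //= (negbTE iA) /G iB mul0r.
rewrite [RHS](bigID (mem A)) /= mulrA; congr (_ * _); last first.
  apply: eq_big => i; rewrite ?inE // => iA.
  have iB : i \notin B by apply: contra iA => /(fintype.subsetP BA).
  by rewrite (negbTE iA) /G (negbTE iB).
transitivity (\prod_(i in A) ((if i \in A :\: B then -1 else 1) * a i)).
  rewrite big_split /=; congr (_ * _).
  rewrite -big_mkcondr /= prodr_const; congr (_ ^+ _).
  rewrite -(cardsID B A) (finset.setIidPr BA) addKn; apply: eq_card => i.
  by rewrite [RHS]unfold_in /= !inE; case: (i \in A); rewrite ?andbF ?andbT.
apply: eq_bigr => i iA; rewrite iA /F !inE iA andbT.
by case: (i \in B); rewrite /= ?mul1r ?mulN1r.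
Qed.

Lemma reliability_sum (K : comNzRingType) (I : finType) (phi : structure_fun I)
    (x : I -> K) :
  reliability phi x = \sum_(B : {set I}) (phi (char_vec B))%:R *
     (\prod_(i in B) x i * \prod_(i in ~: B) (1 - x i)).
Proof.
under [RHS]eq_bigr do rewrite -sum_supersets mulr_sumr.
rewrite /reliability /mobius_coef.
under [LHS]eq_bigr do rewrite mulr_suml.
rewrite (exchange_big_dep xpredT) //=; apply: eq_bigr => B _.
apply: eq_bigr => A _; rewrite big1_eq mulr1 mulrA; congr (_ * _).
exact: mulrC.
Qed.

(** Reflection turns the monomial of a set [A] into a product of [x] over the complement of [A].
    Exchanging the two sums leaves, for each [B], the sum of [sum_supersets] with [a = 1] and
    [b = x]. *)
Lemma horner_reflected_diag (R : comNzRingType) (I : finType)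
    (phi : structure_fun I) (x : R) :
  (reflected #|I| (diag_reliability R phi)).[x] =
  \sum_(B : {set I}) (phi (char_vec B))%:R * (x - 1) ^+ (#|I| - #|B|).
Proof.
have E (B : {set I}) : (x - 1) ^+ (#|I| - #|B|) =
    \prod_(i in B) (1 : R) * \prod_(i in ~: B) (x - 1).
  by rewrite big1_eq mul1r prodr_const [#|~: B|]cardsCs finset.setCK.
under [RHS]eq_bigr do rewrite E -(sum_supersets _ (fun=> 1) (fun=> x)) mulr_sumr.
rewrite (exchange_big_dep xpredT) //=.
rewrite /reflected horner_poly.
have C (k : nat) : (diag_reliability R phi)`_k =
    \sum_(A : {set I} | #|A| == k) mobius_coef R phi A.
  rewrite /diag_reliability /reliability coef_sum [RHS]big_mkcond.
  apply: eq_bigr => A _; rewrite prodr_const.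
  have -> : mobius_coef {poly R} phi A = (mobius_coef R phi A)%:P.
    rewrite /mobius_coef rmorph_sum; apply: eq_bigr => B _.
    by rewrite rmorphM rmorphXn rmorphN1 rmorph_nat.
  by rewrite coefCM coefXn eq_sym; case: eqP; rewrite ?mulr1 ?mulr0.
under [LHS]eq_bigr do rewrite C mulr_suml.
rewrite (exchange_big_dep xpredT) //=; apply: eq_bigr => A _.
have cA : (#|I| - #|A| < #|I|.+1)%N by rewrite ltnS leq_subr.
rewrite (big_pred1 (Ordinal cA)) /=; last first.
  move=> k /=; apply/eqP/eqP => [Ak | -> /=]; last by rewrite subKn ?max_card.
  by apply: val_inj => /=; rewrite Ak subKn // -ltnS.
rewrite /mobius_coef mulr_suml; apply: eq_bigr => B _.
rewrite big1_eq mul1r prodr_const [#|~: A|]cardsCs finset.setCK mulrA; congr (_ * _).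
exact: mulrC.
Qed.

Lemma reliability_inv (R : fieldType) (I : finType) (phi : structure_fun I)
    (x : R) : x != 0 ->
  reliability phi (fun=> x^-1) =
  x ^- #|I| * (reflected #|I| (diag_reliability R phi)).[x].
Proof.
move=> x0; rewrite reliability_sum horner_reflected_diag mulr_sumr.
apply: eq_bigr => B _; rewrite [RHS]mulrCA; congr (_ * _).
rewrite !prodr_const [#|~: B|]cardsCs finset.setCK.
have -> : 1 - x^-1 = x^-1 * (x - 1) by rewrite mulrBr mulVf // mulr1.
by rewrite exprMn mulrA -exprD subnKC ?max_card // exprVn.
Qed.

(** * Multiaffine functions and modular composition *)

Definition upd (I : eqType) (K : Type) (x : I -> K) (i : I) (c : K) : I -> K :=
  fun k => if k == i then c else x k.

(** Degree at most one in each variable, expressed by interpolation between 0 and 1; this applies to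
    a composite without computing its coefficients. *)
Definition multiaffine (I : eqType) (K : nzRingType) (f : (I -> K) -> K) :=
  forall i x, f x = x i * f (upd x i 1) + (1 - x i) * f (upd x i 0).

(** Interpolation replaces one coordinate at a time by 0 or 1; the induction is on a list containing
    all coordinates not yet Boolean. *)
Lemma multiaffine_eq (I : finType) (K : nzRingType) (f g : (I -> K) -> K) :
  multiaffine f -> multiaffine g ->
  (forall v : {ffun I -> bool}, f (fun i => (v i)%:R) = g (fun i => (v i)%:R)) ->
  f =1 g.
Proof.
move=> af ag fg x.
suff H (s : seq I) y : (forall i, i \notin s -> exists b : bool, y i = b%:R) ->
    f y = g y by apply: (H (enum I)) => i; rewrite mem_enum.
elim: s y => [|i s IH] y hy.
  have /boolp.choice[v yv] : forall i, exists b : bool, y i = b%:R.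
    by move=> i; exact: hy.
  have -> : y = fun i => ([ffun i => v i] i)%:R.
    by apply/funext => i; rewrite ffunE.
  exact: fg.
rewrite (af i) (ag i).
have U (b : bool) : f (upd y i b%:R) = g (upd y i b%:R).
  apply: IH => k ks; rewrite /upd; case: eqVneq => [_|ki]; first by exists b.
  by apply: hy; rewrite inE negb_or ki.
by rewrite (U true) (U false).
Qed.

(** In the form of [reliability_sum] each summand has a single factor that depends on [x i], either
    [x i] or [1 - x i]. *)
Lemma multiaffine_reliability (K : comNzRingType) (I : finType)
    (phi : structure_fun I) : multiaffine (@reliability K I phi).
Proof.
move=> i x; rewrite !reliability_sum !mulr_sumr -big_split /=.
have E y (B : {set I}) : \prod_(i in B) y i * \prod_(i in ~: B) (1 - y i) =
    \prod_i (if i \in B then y i else 1 - y i) :> K.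
  rewrite [RHS](bigID (mem B)) /=; congr (_ * _); apply: eq_big => k //.
  - by move=> ->.
  - by rewrite inE.
  - by rewrite inE => /negbTE ->.
apply: eq_bigr => B _; rewrite !E !(bigD1 i (P := xpredT)) //=.
set c := (phi _)%:R.
have Q z : \prod_(k | k != i) (if k \in B then upd x i z k else 1 - upd x i z k) =
   \prod_(k | k != i) (if k \in B then x k else 1 - x k).
  by apply: eq_bigr => k /negbTE ki; rewrite /upd ki.
rewrite !Q /upd eqxx; case: (i \in B).
  by rewrite mul0r !mulr0 addr0 mul1r mulrCA.
by rewrite subrr subr0 mul0r !mulr0 add0r mul1r mulrCA.
Qed.

Lemma char_vec_setE (I : finType) (v : {ffun I -> bool}) :
  char_vec [set i | v i] = v.
Proof. by apply/ffunP => i; rewrite ffunE inE. Qed.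

Lemma reliability_bool (K : comNzRingType) (I : finType)
    (phi : structure_fun I) (v : {ffun I -> bool}) :
  reliability phi (fun i => (v i)%:R) = (phi v)%:R :> K.
Proof.
rewrite reliability_sum (bigD1 [set i | v i]) //= char_vec_setE.
rewrite [X in _ + X]big1 ?addr0; last first.
  move=> B; rewrite finset.eqEsubset negb_and => /orP[] /fintype.subsetPn[i iB iv].
    move: iv; rewrite inE => /negbTE vi.
    by rewrite (bigD1 i) //= vi mul0r mul0r mulr0.
  move: iB; rewrite inE => vi.
  by rewrite [X in _ * (_ * X)](bigD1 i) ?inE //= vi subrr mul0r !mulr0.
rewrite !big1 ?mulr1 // => i; rewrite !inE; first by move=> /negbTE ->; rewrite subr0.
by move=> ->.
Qed.

(** By [multiaffine_eq] it suffices to compare Boolean points, where the assumed decomposition of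
    [phi] applies. The composite is multiaffine because disjointness lets each variable enter only
    one inner function. *)
Lemma reliability_modules (K : comNzRingType) (I J : finType)
    (A : J -> {set I}) (phi : structure_fun I)
    (chi : forall j, structure_fun {i : I | i \in A j}) (psi : structure_fun J) :
  (forall j k, j != k -> [disjoint A j & A k]) ->
  (forall i, exists j, i \in A j) ->
  (forall x, phi x = psi [ffun j => chi j (restrict_vec (A j) x)]) ->
  forall x : I -> K, reliability phi x =
    reliability psi (fun j => reliability (chi j) (fun i => x (val i))).
Proof.
move=> dis cov hmod; apply: multiaffine_eq => [||v].
- exact: multiaffine_reliability.
- move=> i x; have [j ij] := cov i.
  pose h y j := reliability (chi j) (fun k => y (val k)) : K.
  have E c : h (upd x i c) =
      upd (h x) j (reliability (chi j) (upd (fun k => x (val k)) (Sub i ij) c)).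
    apply/funext => k; rewrite /h /upd; case: eqVneq => [->|kj].
      by congr (reliability _ _); apply/funext => l; rewrite -val_eqE.
    congr (reliability _ _); apply/funext => l; case: eqP => // li.
    move: (valP l); rewrite /= li => ik.
    by have /pred0P/(_ i) := dis _ _ kj; rewrite /= ik ij.
  rewrite -/(h x) -/(h (upd x i 1)) -/(h (upd x i 0)) !E.
  set a := reliability (chi j) _; set b := reliability (chi j) _.
  have hj : h x j = x i * a + (1 - x i) * b.
    by rewrite [LHS](multiaffine_reliability _ (Sub i ij)).
  (* The outer function is affine along coordinate [j] at any value [c], so the affine dependence of
     module [j] on [x i] passes through it. *)
  have L c : reliability psi (upd (h x) j c) =
      c * reliability psi (upd (h x) j 1) + (1 - c) * reliability psi (upd (h x) j 0).
    rewrite (multiaffine_reliability psi j).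
    have U z : upd (upd (h x) j c) j z = upd (h x) j z.
      by apply/funext => k; rewrite /upd; case: eqP.
    by rewrite !U /upd eqxx.
  rewrite (multiaffine_reliability psi j (h x)) (L a) (L b) hj.
  set p := reliability psi _; set q := reliability psi _.
  set t := x i; ring.
- rewrite reliability_bool hmod -reliability_bool; congr (reliability _ _).
  apply/funext => j; rewrite ffunE -reliability_bool; congr (reliability _ _).
  by apply/funext => k; rewrite ffunE.
Qed.

(** * Lifetimes and order statistics of a fixed sample point *)

(** One vector is changed into the other one coordinate at a time; [s] lists the coordinates where
    they may still differ. *)
Lemma semicoherent_mono (I : finType) (phi : structure_fun I)
    (v w : {ffun I -> bool}) :
  semicoherent phi -> (forall i, v i -> w i) -> phi v -> phi w.
Proof.
case=> mono _ _.
suff H (s : seq I) (u : {ffun I -> bool}) : (forall i, i \notin s -> u i = w i) ->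
    (forall i, u i -> w i) -> phi u -> phi w.
  by apply: (H (enum I)) => i; rewrite mem_enum.
elim: s u => [|i s IH] u uw ulew pu.
  by have <- : u = w by apply/ffunP => i; exact: uw.
pose u' := [ffun k => if k == i then w i else u k].
apply: (IH u') => [k ks|k|].
- by rewrite ffunE; case: eqVneq => [->|ki] //; apply: uw; rewrite inE negb_or ki.
- by rewrite ffunE; case: eqVneq => [->|ki] //; exact: ulew.
- have := mono i u u'; rewrite pu ffunE eqxx lt0b; apply=> [k /negbTE ki|].
    by rewrite ffunE ki.
  by have := ulew i; case: (u i) => // ->.
Qed.

Section Pointwise.
Context (R : realType) (I : finType) (phi : structure_fun I).
Hypothesis hphi : semicoherent phi.
Implicit Types (t : I -> R) (B : {set I}).

(** The components with [s <= t i] give the state just before time [s], those with [s < t i] the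
    state at [s]. *)
Definition fails_at t (s : R) : bool :=
  phi [ffun i => s <= t i] && ~~ phi [ffun i => s < t i].

Lemma fails_at_lifetime t s :
  fails_at t s -> sup [set u : R | phi [ffun i => u < t i]]%classic = s.
Proof.
case/andP=> ps ns.
have -> : [set u : R | phi [ffun i => u < t i]]%classic = `]-oo, s[%classic.
  rewrite set_itvE; apply/seteqP; split => u /=.
    apply: contraTT; rewrite -leNgt => su; apply: contra ns.
    by apply: semicoherent_mono => // i; rewrite !ffunE; exact: le_lt_trans.
  move=> us; move: ps; apply: semicoherent_mono => // i; rewrite !ffunE.
  exact: lt_le_trans.
exact: sup_itv.
Qed.

(** The failure time is the largest lifetime just before which the system still works. *)
Lemma fails_at_exists t : exists i, fails_at t (t i).
Proof.
have [_ p0 p1] := hphi.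
(* A component exists because [phi] separates the two constant vectors. *)
case: (pickP (mem I)) => [i0 _|I0]; last first.
  suff E : [ffun=> false] = [ffun=> true] :> {ffun I -> bool} by rewrite E p1 in p0.
  by apply/ffunP => i; have := I0 i.
pose Q i := phi [ffun k => t i <= t k].
have [i1 _ i1P] := @arg_minP _ _ I i0 xpredT t isT.
have Q1 : Q i1.
  suff E : [ffun k => t i1 <= t k] = [ffun=> true] by rewrite /Q E p1.
  by apply/ffunP => k; rewrite !ffunE; exact: i1P.
have [i Qi iP] := @arg_maxP _ _ I i1 Q t Q1.
exists i; rewrite /fails_at -/(Q i) Qi /=; apply/negP => pi.
have [k0 k0P] : exists k, t i < t k.
  apply/existsP; apply: contraTT pi; rewrite negb_exists => /forallP nt.
  suff -> : [ffun k => t i < t k] = [ffun=> false] by rewrite p0.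
  by apply/ffunP => j; rewrite !ffunE (negbTE (nt j)).
(* [t k] is the next lifetime after [t i]; a system still working at [t i] would work until just
   before [t k], against the maximality of [t i]. *)
have [k kP kmin] := @arg_minP _ _ I k0 (fun k => t i < t k) t k0P.
have : Q k.
  move: pi; apply: semicoherent_mono => // j; rewrite !ffunE; exact: kmin.
by move/iP => /=; rewrite leNgt kP.
Qed.

(** Ties are allowed: a repeated value holds all the ranks of its block in the sorted list. *)
Definition rank_at t (k : nat) (s : R) : bool :=
  (#|[set i | (t i < s)%R]| < k <= #|[set i | (t i <= s)%R]|)%N.

Lemma count_set (p : pred I) : count p (enum I) = #|[set i | p i]|.
Proof.
rewrite -sum1_count -sum1_card big_enum_cond.
by apply: eq_bigl => i; rewrite !inE.
Qed.

Lemma rank_atE t k s : (0 < k)%N -> rank_at t k s =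
  (count (< s) (sort <=%R [seq t i | i <- enum I]) <= k.-1 <
   count (<= s) (sort <=%R [seq t i | i <- enum I]))%N.
Proof.
have cm p : count p [seq t i | i <- enum I] = #|[set i | p (t i)]|.
  by rewrite count_map count_set.
case: k => // k _; rewrite /rank_at !(seq.permP (permEl (perm_sort _ _))).
by rewrite !cm ltnS.
Qed.

Lemma rank_at_nth t k s : (0 < k)%N -> rank_at t k s ->
  nth 0 (sort <=%R [seq t i | i <- enum I]) k.-1 = s.
Proof.
by move=> k0; rewrite rank_atE //; apply: nth_count_eq; exact: sort_le_sorted.
Qed.

Lemma nth_rank_at t k : (0 < k <= #|I|)%N ->
  exists2 i, rank_at t k (t i) &
    nth 0 (sort <=%R [seq t i | i <- enum I]) k.-1 = t i.
Proof.
case/andP=> k0 kI; set s := sort _ _; set x := nth _ _ _.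
have ss : sorted <=%O s by exact: sort_le_sorted.
have sk : (k.-1 < size s)%N by rewrite size_sort size_map -cardE prednK.
have /mapP[i _ xi] : x \in [seq t i | i <- enum I] by rewrite -(mem_sort <=%R) mem_nth.
exists i => //; rewrite rank_atE // -xi -/s; apply/andP; split.
  by rewrite leqNgt; apply/negP => /(nth_count_lt 0 ss); rewrite ltxx.
rewrite ltnNge; apply/negP => le.
by have := @nth_count_gt _ _ x 0 s k.-1 ss; rewrite le sk ltxx => /(_ isT).
Qed.

(** The supremum and the sort are traded for comparisons between lifetimes, ties included. This form
    serves both measurability and the combinatorics of longest-lived sets. *)
Lemma lifetime_order_stat t k : (0 < k <= #|I|)%N ->
  sup [set u : R | phi [ffun i => u < t i]]%classic =
    nth 0 (sort <=%R [seq t i | i <- enum I]) k.-1 <->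
  exists i, fails_at t (t i) && rank_at t k (t i).
Proof.
move=> kI; split=> [|[i /andP[fi ri]]]; last first.
  by rewrite (fails_at_lifetime fi) (rank_at_nth _ ri) //; case/andP: kI.
have [j ri ->] := nth_rank_at t kI; have [i fi] := fails_at_exists t.
by rewrite (fails_at_lifetime fi) => ij; exists j; rewrite ri -ij fi.
Qed.

End Pointwise.

(** * Sets of longest-lived components *)

Section Topset.
Context (R : realType) (I : finType).
Implicit Types (t : I -> R) (B : {set I}).

Definition topset t B : bool :=
  [forall i in B, forall j in ~: B, t j < t i].

Lemma topsetP t B :
  reflect (forall i j, i \in B -> j \notin B -> t j < t i) (topset t B).
Proof.
apply: (iffP forall_inP) => H i; [move=> j iB jB|move=> iB].
  by apply: (forall_inP (H i iB)); rewrite inE.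
by apply/forall_inP => j; rewrite inE; exact: H.
Qed.

(** Two different sets of equal size each have an element outside the other, and each of these two
    elements would have to outlive the other. *)
Lemma topset_uniq t B B' : topset t B -> topset t B' -> #|B| = #|B'| -> B = B'.
Proof.
move=> /topsetP tB /topsetP tB' cBB'; apply/eqP; rewrite eqEcard cBB' leqnn andbT.
apply/fintype.subsetP => i iB; apply/negPn/negP => iB'.
have /fintype.subsetPn[j jB' jB] : ~~ (B' \subset B).
  apply/negP => sB; have /eqP E : B' == B by rewrite eqEcard sB cBB' leqnn.
  by rewrite E iB in iB'.
by have := lt_trans (tB _ _ iB jB) (tB' _ _ jB' iB'); rewrite ltxx.
Qed.

(** The new component is the longest-lived one outside [B]; injectivity of [t] makes it the only one
    with its lifetime. *)
Lemma topset_next t B : injective t -> topset t B -> B != [set: I] ->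
  exists i, [/\ i \notin B, B = [set j | t i < t j],
                i |: B = [set j | t i <= t j] & topset t (i |: B)].
Proof.
move=> injt /topsetP tB; rewrite -finset.subTset => /fintype.subsetPn[i0 _ i0B].
have [i iB imax] := @arg_maxP _ _ I i0 (fun k => k \notin B) t i0B.
have E j : (t i < t j) = (j \in B).
  have [jB|jB] := boolP (j \in B); first exact: tB.
  by rewrite ltNge (imax j jB : t j <= t i).
have E' j : (t i <= t j) = (j \in i |: B).
  by rewrite le_eqVlt E !inE (inj_eq injt) eq_sym.
exists i; split => //; try by apply/setP => j; rewrite inE ?E ?E'.
apply/topsetP => j k; rewrite -!E' -ltNge => ij ki; exact: lt_le_trans ij.
Qed.

Lemma topset_exists t m : injective t -> (m <= #|I|)%N ->
  exists2 B : {set I}, #|B| = m & topset t B.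
Proof.
move=> injt; elim: m => [|m IH] mI.
  by exists finset.set0; rewrite ?cards0 //; apply/topsetP => i j; rewrite inE.
have [B cB tB] := IH (ltnW mI).
have [|i [iB _ _ tiB]] := topset_next injt tB.
  by apply/eqP => BT; move: mI; rewrite -cB BT cardsT ltnn.
by exists (i |: B) => //; rewrite cardsU1 iB cB.
Qed.

(* Without ties, the component with the k-th smallest lifetime is the one in
   [B' :\: B]. *)
Lemma topset_fails_rank (phi : structure_fun I) t k B B' : injective t ->
  (0 < k <= #|I|)%N -> topset t B -> topset t B' ->
  #|B| = (#|I| - k)%N -> #|B'| = (#|I| - k.-1)%N ->
  B \subset B' /\
  ((exists i, fails_at phi t (t i) && rank_at t k (t i)) <->
   phi (char_vec B') && ~~ phi (char_vec B)).
Proof.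
move=> injt /andP[k0 kI] tB tB' cB cB'.
have BT : B != [set: I].
  apply/eqP => BT; move: cB; rewrite BT cardsT => E.
  have := subnK kI; rewrite -E => /eqP.
  by rewrite -{2}[#|I|]addn0 eqn_add2l eqn0Ngt k0.
have [i [iB EB EiB tiB]] := topset_next injt tB BT.
have EB' : B' = i |: B.
  apply: (topset_uniq tB' tiB); rewrite cardsU1 iB cB cB'.
  by case: k k0 kI {cB cB'} => // k _ kI; rewrite add1n subnSK.
have fE : fails_at phi t (t i) = phi (char_vec B') && ~~ phi (char_vec B).
  rewrite /fails_at; congr (phi _ && ~~ phi _); apply/ffunP => j; rewrite !ffunE.
    by rewrite EB' EiB inE.
  by rewrite EB inE.
have ri : rank_at t k (t i).
  rewrite /rank_at [#|[set j | t j <= t i]|]cardsCs [#|[set j | t j < t i]|]cardsCs.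
  have -> : ~: [set j | t j < t i] = B'.
    by rewrite EB' EiB; apply/setP => j; rewrite !inE leNgt.
  have -> : ~: [set j | t j <= t i] = B.
    by rewrite [RHS]EB; apply/setP => j; rewrite !inE ltNge.
  rewrite cB cB' !subKn //; last exact: leq_trans (leq_pred k) kI.
  by rewrite prednK // leqnn.
split; first by rewrite EB' finset.subsetUr.
split=> [[j /andP[fj rj]]|].
  have tij : t i = t j by rewrite -(rank_at_nth k0 ri) (rank_at_nth k0 rj).
  by rewrite -fE tij.
by rewrite -fE => fi; exists i; rewrite fi.
Qed.

End Topset.

(** * Laws of independent families *)

(* [P] is junk on sets that are not measurable, and so is [signature]: its
   events have to be shown measurable including the sample points with ties. *)
Lemma order_measurable d (Om : measurableType d) (R : realType) (I : finType)
    (X : I -> Om -> R) (A : set Om) :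
  (forall i, measurable_fun [set: Om]%classic (X i)) ->
  (forall w w', (forall i j, (X i w < X j w) = (X i w' < X j w')) ->
     A w -> A w') ->
  measurable A.
Proof.
move=> mX HA.
(* [g] records the strict order pattern of the sample point. It takes finitely many values, and [A]
   is a union of its fibres. *)
pose g w : {ffun I * I -> bool} := [ffun p => X p.1 w < X p.2 w].
have mg M : measurable (g @^-1` [set M])%classic.
  have -> : (g @^-1` [set M] = \bigcap_(p in [set: I * I])
      ((fun w => X p.1 w < X p.2 w)%R @^-1` [set M p]))%classic.
    apply/seteqP; split=> w /= => [<- p _ | H]; first by rewrite /= ffunE.
    by apply/ffunP => p; rewrite ffunE; exact: H.
  apply: fin_bigcap_measurable => [|p _]; first exact: finite_finset.
  rewrite -[X in measurable X]setTI.
  exact: measurable_fun_ltr.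
have -> : A = (\bigcup_(M in g @` A) (g @^-1` [set M]))%classic.
  apply/seteqP; split=> w; first by move=> Aw; exists (g w) => //; exists w.
  move=> [_ [w' Aw' <-]] /= gw; apply: HA Aw' => i j.
  by have /ffunP/(_ (i, j)) := gw; rewrite !ffunE.
by apply: fin_bigcup_measurable => //; exact: finite_finset.
Qed.

Section Rectangles.
Context (R : realType) (I : finType).

(** Generators of the product sigma-algebra on [I -> R], forming a pi-system for Dynkin
    induction. *)
Definition rectangles : set (set (I -> R)) :=
  [set C | exists2 B : I -> set R, (forall i, measurable (B i)) &
     C = [set x | forall i, B i (x i)]]%classic.

Lemma rectangles_setI : setI_closed rectangles.
Proof.
move=> _ _ [B mB ->] [C mC ->]; exists (fun i => B i `&` C i)%classic.
  by move=> i; exact: measurableI.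
apply/seteqP; split=> x /=; first by case=> Bx Cx i; split.
by move=> H; split=> i; case: (H i).
Qed.

Lemma measurable_coordinate i :
  measurable_fun [set: g_sigma_algebraType rectangles]%classic
    (fun x : g_sigma_algebraType rectangles => x i).
Proof.
move=> _ B mB; rewrite setTI; apply: sub_sigma_algebra.
exists (fun j => if j == i then B else setT) => [j|]; first by case: ifP.
apply/seteqP; split=> x /= => [Bx j|/(_ i)]; last by rewrite eqxx.
by case: eqP => // ->.
Qed.

End Rectangles.

Section Law.
Context d (Om : measurableType d) (R : realType) (P : probability Om R).

(** Serves both for restricting to the components of a module and for permuting the components. *)
Lemma independent_inj (I J : finType) (T : I -> {RV P >-> R}) (f : J -> I) :
  injective f -> mutually_independent T -> mutually_independent (T \o f).
Proof.
move=> injf indT K B mB.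
(* [B'] carries the events over to [I] along [f], with the whole space as a filler off the image. *)
pose B' i := if [pick j | f j == i] is Some j then B j else setT.
have B'f j : B' (f j) = B j.
  rewrite /B'; case: pickP => [k /eqP/injf -> //|/(_ j)]; by rewrite eqxx.
have mB' i : measurable (B' i) by rewrite /B'; case: pickP.
have := indT (f @: K)%SET B' mB'.
rewrite !big_imset /=; try by move=> i j _ _; exact: injf.
by under eq_bigr do rewrite B'f; under [in RHS]eq_bigr do rewrite B'f.
Qed.

Lemma iid_continuous_inj (I J : finType) (T : I -> {RV P >-> R}) (f : J -> I) :
  injective f -> iid_continuous T -> iid_continuous (T \o f).
Proof.
move=> injf [indT idT contT]; split; first exact: independent_inj.
  by move=> i j; exact: idT.
by move=> i; exact: contT.
Qed.

Lemma rectangle_law (I : finType) (T : I -> {RV P >-> R}) (B : I -> set R) :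
  mutually_independent T -> (forall i, measurable (B i)) ->
  P [set w | forall i, B i (T i w)]%classic = (\prod_i P (T i @^-1` B i)%classic)%E.
Proof.
move=> indT mB; have := indT [set: I] B mB.
under [in X in _ = X -> _]eq_bigl do rewrite inE.
move=> <-; congr (P _); rewrite -bigcap_seq_cond; apply/seteqP; split=> w /=.
  by move=> H i _; exact: H.
by move=> H i; apply: H; rewrite /= mem_index_enum inE.
Qed.

(** The two laws agree on rectangles by independence and equal marginals, and the sets on which they
    agree form a Dynkin class. *)
Lemma joint_law_eq (I : finType) (X Y : I -> {RV P >-> R}) :
  mutually_independent X -> mutually_independent Y ->
  (forall i B, measurable B -> P (X i @^-1` B)%classic = P (Y i @^-1` B)%classic) ->
  forall C, measurable (C : set (g_sigma_algebraType (@rectangles R I))) ->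
    P [set w | C (fun i => X i w)]%classic = P [set w | C (fun i => Y i w)]%classic.
Proof.
move=> indX indY XY.
have mjoint (Z : I -> {RV P >-> R}) (C : set (g_sigma_algebraType (@rectangles R I))) :
    measurable C -> measurable [set w | C (fun i => Z i w)]%classic.
  move=> mC; rewrite -[X in measurable X]setTI.
  have mZ : measurable_fun [set: Om]%classic
      ((fun w i => Z i w) : Om -> g_sigma_algebraType (@rectangles R I)).
    have := @measurability _ _ Om (g_sigma_algebraType (@rectangles R I)) setT
      (fun w i => Z i w) (@rectangles R I) erefl; apply.
    move=> _ [_ [B mB ->] <-].
    rewrite setTI (_ : _ @^-1` _ = \bigcap_(i in [set: I]) (Z i @^-1` B i))%classic.
      apply: fin_bigcap_measurable => [|i _]; first exact: finite_finset.
      exact: measurable_funPTI.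
    by apply/seteqP; split=> w /= H i; [move=> _; exact: H|exact: H].
  exact: mZ.
pose same_law (C : set (g_sigma_algebraType (@rectangles R I))) :=
  P [set w | C (fun i => X i w)]%classic = P [set w | C (fun i => Y i w)]%classic.
have := @dynkin_induction _ (g_sigma_algebraType (@rectangles R I))
  (@rectangles R I) same_law erefl (@rectangles_setI R I) erefl; apply.
- by move=> C [B mB ->] /=; rewrite /same_law !rectangle_law //; apply: eq_bigr => i _; exact: XY.
- move=> C mC PC; have := mjoint X _ mC; have := mjoint Y _ mC => mY mX.
  rewrite /same_law (_ : [set w | (~` C) _] = ~` [set w | C (fun i => X i w)])%classic //.
  rewrite [in RHS](_ : [set w | (~` C) _] = ~` [set w | C (fun i => Y i w)])%classic //.
  by rewrite !probability_setC // PC.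
- move=> F mF tF PF.
  have B (Z : I -> {RV P >-> R}) : P [set w | (\bigcup_k F k) (fun i => Z i w)]%classic =
      (\sum_(0 <= k <oo) P [set w | F k (fun i => Z i w)]%classic)%E.
    rewrite (_ : [set w | _] = \bigcup_k [set w | F k (fun i => Z i w)])%classic //.
    rewrite measure_bigcup //; last 2 first.
    + by move=> k _; exact: mjoint.
    + apply/trivIsetP => j k _ _ jk; move/trivIsetP : tF => /(_ j k Logic.I Logic.I jk) /seteqP[E _].
      by apply/seteqP; split=> // w /= H; apply: (E (fun i => Z i w)).
    by apply: eq_eseriesl => k; rewrite in_setT.
  by rewrite /same_law !B; apply: eq_eseriesr => k _; exact: PF.
Qed.

(** For [b < a] the events [X <= b] and [X = a] are disjoint and lie in [X <= a], so the atom has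
    mass at most [cdf X a - cdf X b]; then [b] tends to [a] from the left. *)
Lemma atomless (X : {RV P >-> R}) (a : R) :
  continuous (cdf X) -> P (X @^-1` [set a])%classic = 0%E.
Proof.
move=> cX; apply/eqP; rewrite eq_le measure_ge0 andbT.
have fa : cdf X a \is a fin_num by rewrite fin_num_measure.
have fm : P (X @^-1` [set a])%classic \is a fin_num.
  by rewrite fin_num_measure //; exact: measurable_funPTI.
suff H : (cdf X a <= cdf X a - P (X @^-1` [set a])%classic)%E.
  by move: H; rewrite leeBrDr // addeC -leeBrDr // subee.
have cl : (cdf X x @[x --> a^'-] --> cdf X a)%classic.
  exact: cvg_at_left_filter (cX a).
apply: (cvge_to_le cl); near=> b.
have ba : b < a by near: b; exact: nbhs_left_lt.
rewrite leeBrDr // /cdf /distribution /pushforward -measureU.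
- apply: le_measure; rewrite ?inE.
  + by apply: measurableU; exact: measurable_funPTI.
  + exact: measurable_funPTI.
  + move=> w /= [|->]; rewrite !in_itv /= => //; move/le_trans; apply; exact: ltW.
- exact: measurable_funPTI.
- exact: measurable_funPTI.
- apply/seteqP; split=> // w /= []; rewrite in_itv /= => Xb Xa.
  by move: ba; rewrite -Xa ltNge Xb.
Unshelve. all: by end_near.
Qed.

End Law.

(** * Boland's formula *)

Section Boland.
Context d (Om : measurableType d) (R : realType) (P : probability Om R).

(** Independence makes the law of the pair the product of its marginals. The sections of the
    diagonal are singletons, which are null for the law of [Y]. *)
Lemma no_tie (X Y : {RV P >-> R}) :
  (forall A B, measurable A -> measurable B ->
    P (X @^-1` A `&` Y @^-1` B)%classic =
    (P (X @^-1` A)%classic * P (Y @^-1` B)%classic)%E) ->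
  continuous (cdf Y) -> P [set w | X w = Y w]%classic = 0%E.
Proof.
move=> XY cY.
have mZ : measurable_fun [set: Om]%classic (fun w => (X w, Y w)).
  exact: measurable_fun_pair.
pose Z : {mfun Om >-> (R * R)%type} := mfun_Sub (mem_set mZ).
pose D : set (R * R) := [set p | p.1 = p.2]%classic.
have mD : measurable D.
  have -> : D = ((fun p : R * R => p.1 == p.2) @^-1` [set true])%classic.
    by apply/seteqP; split=> p /= /eqP.
  rewrite -[X in measurable X]setTI.
  exact: measurable_fun_eqr.
have := @product_measure_unique _ _ _ _ R (distribution P X) (distribution P Y)
  (distribution P Z) XY D mD.
rewrite -[P _]/(distribution P Z D) => <-.
rewrite /product_measure1; apply: integral0_eq => x _ /=.
have -> : xsection D x = [set x]%classic.
  by apply/seteqP; split=> y; rewrite /xsection /= inE /D /=.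
exact: atomless.
Qed.

Lemma eq_measure_ae (A B : set Om) : measurable A -> measurable B ->
  {ae P, forall w, A w <-> B w} -> P A = P B.
Proof.
move=> mA mB [N [mN N0 sN]].
suff H (C D : set Om) : measurable C -> measurable D ->
    (C `\` D `<=` N)%classic -> P C = P (C `&` D)%classic.
  rewrite (H A B) //; last by move=> w [Aw nB]; apply: sN => /= -[/(_ Aw)].
  by rewrite setIC -(H B A) // => w [Bw nA]; apply: sN => /= -[_ /(_ Bw)].
move=> mC mD sCD; rewrite (measureDI _ mC mD).
rewrite [X in (X + _)%E](_ : _ = 0%E) ?add0e //; apply: measure_negligible.
  exact: measurableD.
by exists N.
Qed.

Context (I : finType) (T : I -> {RV P >-> R}).
Hypothesis iidT : iid_continuous T.

Lemma ae_injective : {ae P, forall w, injective (T ^~ w)}.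
Proof.
have [indT _ cT] := iidT.
have H : {ae P, forall w, forall p : I * I, p.1 != p.2 -> T p.1 w <> T p.2 w}.
  apply: filter_forall => -[i j] /=.
  case: eqVneq => [_|ij]; first exact: aeW.
  exists [set w | T i w = T j w]%classic; split.
  - apply: (order_measurable (X := T)) => [k|w w' ww' /= e]; first by [].
    by apply/eqP; rewrite eq_le !leNgt -!ww' e ltxx.
  - apply: no_tie; last exact: cT.
    move=> A B mA mB.
    have := indT [set i; j] (fun k => if k == i then A else B).
    rewrite !big_setU1 ?inE //= !big_set1 eqxx eq_sym (negbTE ij); apply=> k.
    by case: ifP.
  - by move=> w /= h; apply: contrapT => e; apply: h => _.
apply: filterS H => w H i j Tij; apply/eqP/negPn/negP => ij.
exact: (H (i, j) ij).
Qed.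

Lemma measurable_topset B : measurable [set w | topset (T ^~ w) B]%classic.
Proof.
apply: (order_measurable (X := T)) => [k|w w' ww' /= /topsetP tB]; first by [].
by apply/topsetP => i j iB jB; rewrite -ww'; exact: tB.
Qed.

(** Enumerate [B] first and then its complement, do the same for [C], and match the two enumerations
    position by position. *)
Lemma exists_inj_set (B C : {set I}) : #|B| = #|C| ->
  exists2 f : I -> I, injective f & forall i, (f i \in C) = (i \in B).
Proof.
move=> BC; pose s (D : {set I}) := enum D ++ enum (~: D).
have sU D : uniq (s D).
  rewrite cat_uniq !enum_uniq andbT; apply/hasPn => i.
  by rewrite !mem_enum inE.
have sI D i : i \in s D by rewrite mem_cat !mem_enum inE orbN.
have ss D : size (s D) = #|I|.
  by rewrite size_cat -!cardE cardsC.
have sz i D : (index i (s D) < #|I|)%N by rewrite -(ss D) index_mem.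
exists (fun i => nth i (s C) (index i (s B))) => [i j|i].
  rewrite (set_nth_default j) ?ss // => /eqP.
  rewrite nth_uniq ?ss // => /eqP E.
  by rewrite -[i](nth_index i (sI B i)) E nth_index.
have H D k (x : I) : (k < #|I|)%N -> (nth x (s D) k \in D) = (k < #|D|)%N.
  move=> kI; rewrite nth_cat -cardE; case: ltnP => [kD|Dk].
    by rewrite -mem_enum mem_nth // -cardE.
  apply/negbTE; rewrite -finset.in_setC -mem_enum mem_nth // -cardE.
  by rewrite -(ltn_add2l #|D|) subnKC // cardsC.
by rewrite H // -BC -(H B _ i) // nth_index.
Qed.

(** Exchangeability: permuting the components by a bijection that maps [B] onto [C] keeps the joint
    law. *)
Lemma topset_law (B C : {set I}) : #|B| = #|C| ->
  P [set w | topset (T ^~ w) B]%classic = P [set w | topset (T ^~ w) C]%classic.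
Proof.
move=> BC; have [f injf fC] := exists_inj_set BC.
have [indT idT _] := iidT.
pose E : set (g_sigma_algebraType (@rectangles R I)) := [set x | topset x B]%classic.
have mE : measurable E.
  apply: (order_measurable (X := fun i (x : g_sigma_algebraType (@rectangles R I)) => x i)).
    exact: measurable_coordinate.
  move=> x y xy /= /topsetP tB.
  by apply/topsetP => i j iB jB; rewrite -xy; exact: tB.
have := @joint_law_eq _ _ _ _ I T (T \o f) indT (independent_inj injf indT) _ E mE.
rewrite /E /= => -> //; last by move=> i A mA; exact: idT.
congr (P _); apply/seteqP; split=> w /= /topsetP tB; apply/topsetP => i j.
  have [g fK gK] := injF_bij injf.
  by rewrite -[i]gK -[j]gK !fC; exact: tB.
by rewrite -!fC; exact: tB.
Qed.

(** With ties there may be no [topset] of size [m]; the existential form then makes the event fail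
    instead of requiring a choice. *)
Definition top_event m (Q : pred {set I}) : set Om :=
  [set w | exists2 B, topset (T ^~ w) B & (#|B| == m) && Q B]%classic.

Lemma measurable_top_event m Q : measurable (top_event m Q).
Proof.
apply: (order_measurable (X := T)) => [k|w w' ww' /= [B /topsetP tB mQ]] //.
exists B => //; apply/topsetP => i j iB jB; rewrite -ww'; exact: tB.
Qed.

(** By [topset_uniq] the events of different sets of size [m] are disjoint, even at sample points
    with ties. *)
Lemma top_event_sum m Q :
  P (top_event m Q) =
  (\sum_(B : {set I} | (#|B| == m) && Q B) P [set w | topset (T ^~ w) B]%classic)%E.
Proof.
have -> : top_event m Q =
    (\bigcup_(B in [set B : {set I} | (#|B| == m) && Q B]%classic)
      [set w | topset (T ^~ w) B])%classic.
  by apply/seteqP; split=> w /= [B]; [move=> tB mQ|move=> /= mQ tB]; exists B.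
rewrite measure_fin_bigcup.
- by rewrite [RHS]bigfs ?index_enum_uniq // => B _; rewrite mem_index_enum.
- exact: finite_finset.
- move=> B C /= /andP[/eqP Bm _] /andP[/eqP Cm _] [w [/= tB tC]].
  by apply: (topset_uniq tB tC); rewrite Bm Cm.
- by move=> B _; exact: measurable_topset.
Qed.

Lemma top_event_prob m Q : (m <= #|I|)%N ->
  'C(#|I|, m)%:R * fine (P (top_event m Q)) =
  \sum_(B : {set I} | #|B| == m) (Q B)%:R.
Proof.
move=> mI.
have [B0 cB0] : exists B : {set I}, #|B| = m.
  have : (0 < #|[set B : {set I} | #|B| == m]|)%N by rewrite card_draws bin_gt0.
  by case/card_gt0P => B; rewrite inE => /eqP; exists B.
pose p := fine (P [set w | topset (T ^~ w) B0]%classic).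
have E Q' : fine (P (top_event m Q')) = \sum_(B : {set I} | #|B| == m) (Q' B)%:R * p.
  rewrite top_event_sum.
  rewrite (eq_bigr (fun=> p%:E)) => [|B /andP[/eqP cB _]]; last first.
    rewrite /p fineK ?fin_num_measure //; last exact: measurable_topset.
    by apply: topset_law; rewrite cB cB0.
  rewrite sumEFin /= big_mkcondr; apply: eq_bigr => B _.
  by case: (Q' B); rewrite ?mul1r ?mul0r.
(* For [Q = predT] the event has probability one, since a [topset] of size [m] almost surely exists;
   this determines the common probability [p]. *)
have p1 : 'C(#|I|, m)%:R * p = 1.
  have <- : fine (P (top_event m predT)) = 'C(#|I|, m)%:R * p.
    rewrite E -mulr_suml; congr (_ * _); rewrite sumr_const -card_draws.
    by congr (_ *+ _); apply: eq_card => B; rewrite inE.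
  rewrite (@eq_measure_ae _ setT) ?probability_setT //.
    exact: measurable_top_event.
  apply: filterS ae_injective => w injT; split=> // _.
  have [B cB tB] := topset_exists injT mI.
  by exists B => //; rewrite cB eqxx.
by rewrite E -mulr_suml mulrCA p1 mulr1.
Qed.

Context (phi : structure_fun I) (hphi : semicoherent phi).

Let works B := phi (char_vec B).

Lemma signature_diff k : (0 < k <= #|I|)%N ->
  signature T phi k = fine (P (top_event (#|I| - k.-1)%N works))
                    - fine (P (top_event (#|I| - k)%N works)).
Proof.
move=> kI; set G' := top_event _ _; set G := top_event _ _.
have mG' : measurable G' by exact: measurable_top_event.
have mG : measurable G by exact: measurable_top_event.
have E : [set w | system_lifetime T phi w = order_stat T k w]%classic =
  [set w | exists i, fails_at phi (T ^~ w) (T i w) && rank_at (T ^~ w) k (T i w)]%classic.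
  by apply/seteqP; split=> w /=; rewrite (lifetime_order_stat hphi (T ^~ w) kI).
have mS : measurable [set w | system_lifetime T phi w = order_stat T k w]%classic.
  rewrite E; apply: (order_measurable (X := T)) => [//|w w' ww' /= [i iP]].
  exists i; move: iP; rewrite /fails_at /rank_at.
  have ww'e j : (T i w <= T j w) = (T i w' <= T j w') by rewrite !leNgt ww'.
  have -> : [ffun j => T i w <= T j w] = [ffun j => T i w' <= T j w'].
    by apply/ffunP => j; rewrite !ffunE ww'e.
  have -> : [ffun j => T i w < T j w] = [ffun j => T i w' < T j w'].
    by apply/ffunP => j; rewrite !ffunE ww'.
  have -> : [set j | T j w < T i w] = [set j | T j w' < T i w'].
    by apply/setP => j; rewrite !inE ww'.
  have -> // : [set j | T j w <= T i w] = [set j | T j w' <= T i w'].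
  by apply/setP => j; rewrite !inE !leNgt ww'.
(* [G] and [G'] say that [phi] holds at the longest-lived sets of sizes [#|I| - k] and one more.
   Monotonicity nests [G] in [G'] almost surely, so the probability of their difference is a
   difference of probabilities. *)
have key w : injective (T ^~ w) ->
    (G w -> G' w) /\ (system_lifetime T phi w = order_stat T k w <-> G' w /\ ~ G w).
  move=> injT.
  have [B cB tB] := topset_exists injT (leq_subr k #|I|).
  have [B' cB' tB'] := topset_exists injT (leq_subr k.-1 #|I|).
  have GE : G w <-> works B.
    split=> [[C tC /andP[/eqP cC]]|]; last by exists B; rewrite ?cB ?eqxx.
    by rewrite (topset_uniq tC tB) // cC cB.
  have G'E : G' w <-> works B'.
    split=> [[C tC /andP[/eqP cC]]|]; last by exists B'; rewrite ?cB' ?eqxx.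
    by rewrite (topset_uniq tC tB') // cC cB'.
  have [sBB' SE] := topset_fails_rank phi injT kI tB tB' cB cB'.
  split.
    rewrite GE G'E; apply: semicoherent_mono => // i; rewrite !ffunE.
    exact: (fintype.subsetP sBB').
  rewrite /system_lifetime /order_stat (lifetime_order_stat hphi (T ^~ w) kI) SE GE G'E.
  by split=> [/andP[? /negP]|[? /negP ?]] //; apply/andP.
rewrite /signature (@eq_measure_ae _ (G' `\` G)%classic) //.
- rewrite measureD //; last by rewrite ltey_eq fin_num_measure.
  rewrite fineB ?fin_num_measure //; last exact: measurableI.
  congr (_ - fine _); apply: eq_measure_ae => //; first exact: measurableI.
  apply: filterS ae_injective => w /key[GG' _]; split=> [[]|Gw] //.
  by split=> //; exact: GG'.
- exact: measurableD.
- by apply: filterS ae_injective => w /key[_].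
Qed.

Lemma tail_signature_sum k : (k <= #|I|)%N ->
  'C(#|I|, k)%:R * tail_signature T phi k =
  \sum_(B : {set I} | #|B| == (#|I| - k)%N) (phi (char_vec B))%:R.
Proof.
move=> kI; rewrite -(top_event_prob works (leq_subr k _)) bin_sub //.
congr (_ * _); rewrite /tail_signature.
pose u i := fine (P (top_event (#|I| - i)%N works)).
(* [u #|I|] vanishes because [phi] fails at the empty set; subtracting it gives the two ends of a
   telescoping sum. *)
rewrite -[RHS]/(u k); have -> : u k = u k - u #|I|.
  rewrite {3}/u subnn (_ : top_event 0 works = set0) ?measure0 ?subr0 //.
  apply/seteqP; split=> // w [B _] /=; rewrite cards_eq0 => /andP[/eqP ->].
  have [_ + _] := hphi; rewrite /works.
  suff -> : char_vec finset.set0 = [ffun=> false] :> {ffun I -> bool} by move=> ->.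
  by apply/ffunP => i; rewrite !ffunE inE.
rewrite big_add1 /= big_nat_cond.
rewrite (eq_bigr (fun i => - (u i.+1 - u i))); last first.
  move=> i /andP[/andP[_ iI] _]; rewrite signature_diff; last by [].
  by rewrite opprB.
by rewrite -big_nat_cond sumrN telescope_sumr // opprB.
Qed.

End Boland.

(** * Reflected polynomials and tail signatures *)

Lemma reflected_tail_signature d (Om : measurableType d) (R : realType)
    (P : probability Om R) (I : finType) (T : I -> {RV P >-> R})
    (phi : structure_fun I) (m : nat) (x : R) :
  #|I| = m -> iid_continuous T -> semicoherent phi ->
  (reflected m (diag_reliability R phi)).[x] =
  \sum_(k < m.+1) 'C(m, k)%:R * tail_signature T phi k * (x - 1) ^+ k.
Proof.
move=> <- iidT hphi; rewrite horner_reflected_diag.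
(* The sets are grouped by the size of their complement, and Boland's formula evaluates each
   group. *)
pose c (B : {set I}) : 'I_#|I|.+1 := inord (#|I| - #|B|).
have cE B : c B = (#|I| - #|B|)%N :> nat by rewrite inordK // ltnS leq_subr.
rewrite (partition_big c xpredT) //=; apply: eq_bigr => k _.
have kI : (k <= #|I|)%N by rewrite -ltnS.
rewrite tail_signature_sum // mulr_suml; apply: eq_big => B.
  rewrite -val_eqE /= cE; apply/eqP/eqP => [<-|->]; last exact: subKn.
  by rewrite subKn // max_card.
by move=> /eqP <-; rewrite cE.
Qed.

Theorem mainTheorem2 (R : realType) (d : measure_display)
  (Omega : measurableType d) (P : probability Omega R)
  (n r : nat)
  (phi : structure_fun 'I_n)
  (T : 'I_n -> {RV P >-> R})
  (A : 'I_r -> {set 'I_n})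
  (chi : forall j : 'I_r, structure_fun {i : 'I_n | i \in A j})
  (psi : structure_fun 'I_r)
  (hphi : semicoherent phi)
  (hT : iid_continuous T)
  (hA_disj : forall j k : 'I_r, j != k -> [disjoint A j & A k])
  (hA_cover : \bigcup_(j < r) A j = [set: 'I_n])
  (hchi : forall j : 'I_r, semicoherent (chi j))
  (hmod : forall x : {ffun 'I_n -> bool},
      phi x = psi [ffun j => chi j (restrict_vec (A j) x)]) :
  let hR : {poly R} := reflected n (diag_reliability R phi) in
  let hRj (j : 'I_r) : {poly R} :=
    reflected #|A j| (diag_reliability R (chi j)) in
  let S := tail_signature T phi in
  let Sj (j : 'I_r) :=
    tail_signature (fun i : {i : 'I_n | i \in A j} => T (val i)) (chi j) in
  (forall x : R, x != 0 ->
     \sum_(k < n.+1) 'C(n, k)%:R * S k * (x - 1) ^+ k = hR.[x]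
     /\ hR.[x] =
        x ^+ n * reliability psi (fun j => x ^- #|A j| * (hRj j).[x]))
  /\
  (forall (j : 'I_r) (x : R),
     (hRj j).[x] =
     \sum_(k < #|A j|.+1) 'C(#|A j|, k)%:R * Sj j k * (x - 1) ^+ k).
Proof.
move=> hR hRj S Sj.
have cardA j : #|{: {i : 'I_n | i \in A j}}| = #|A j| by rewrite card_sig.
have cover i : exists j, i \in A j.
  have : i \in [set: 'I_n] by rewrite inE.
  by rewrite -hA_cover => /bigcupP[j _ ij]; exists j.
split=> [x x0|j x]; last first.
  apply: reflected_tail_signature => //; first exact: cardA.
  (* The lifetimes of a module are the original family taken along the injection [val] of a
     subtype. *)
  exact: iid_continuous_inj val_inj hT.
split; first by rewrite /hR (reflected_tail_signature _ _ hT) ?card_ord.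
(* Evaluation at [x^-1] turns a reflected polynomial into a reliability function on a constant
   vector, where the decomposition in [n] variables applies; the same is then done for each
   module. *)
have E : reliability phi (fun=> x^-1) = x ^- n * hR.[x].
  by rewrite reliability_inv // card_ord.
have -> : hR.[x] = x ^+ n * reliability phi (fun=> x^-1).
  by rewrite E mulVKf // expf_neq0.
rewrite (@reliability_modules R _ _ A phi chi psi hA_disj cover hmod); congr (_ * reliability psi _).
by apply/funext => j; rewrite reliability_inv // cardA.
Qed.
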